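(* For every $\varepsilon>0$ there exists a $3$-connected simple cubic graph $G$ such that every traveling salesman tour of $G$ has length at least $(1.125-\varepsilon)\,|V(G)|$.
   Context: A traveling salesman tour (TSP tour) of a graph $G$ is a closed walk in $G$ that visits every vertex of $G$; its length is the number of edges traversed, counted with multiplicity. *)

(* Defs.v *)
From HB Require Import structures.
From mathcomp Require Import all_boot all_order all_algebra.
From mathcomp Require Export reals.
Set Implicit Arguments. Unset Strict Implicit. Unset Printing Implicit Defensive.

Definition simple_graph (T : finType) (g : rel T) : Prop :=
  irreflexive g /\ symmetric g.

Definition cubic (T : finType) (g : rel T) : Prop :=
  forall v : T, #|[set w | g v w]| = 3.

Definition del_rel (T : finType) (g : rel T) (S : {set T}) : rel T :=
  [rel x y | [&& g x y, x \notin S & y \notin S]].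

Definition k_connected (k : nat) (T : finType) (g : rel T) : Prop :=
  k < #|T| /\
  forall S : {set T}, #|S| < k ->
    forall u v : T, u \notin S -> v \notin S -> connect (del_rel g S) u v.

(* A TSP tour: a closed walk x :: p (x, p_1, ..., p_n = x), consecutive
   vertices adjacent, visiting every vertex; its length is size p, the
   number of edges traversed with multiplicity. *)
Definition tsp_tour (T : finType) (g : rel T) (x : T) (p : seq T) : Prop :=
  [/\ path g x p, last x p = x & forall v : T, v \in x :: p].

Definition tour_length (T : Type) (p : seq T) : nat := size p.

(* Main.v *)
Require Import Defs.
From HB Require Import structures.
From mathcomp Require Import all_boot all_order all_algebra.
From mathcomp Require Import reals zify lra.
Import Order.TTheory GRing.Theory Num.Theory.
Set Implicit Arguments. Unset Strict Implicit. Unset Printing Implicit Defensive.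

(** Removing two adjacent vertices from the Petersen graph leaves a gadget with
    8 vertices and 4 half-edges; the graph is a necklace of [m] such gadgets,
    consecutive ones being joined by two edges. Let [J] be the set of edges
    that a tour traverses an odd number of times. All degrees in [J] are even,
    hence 0 or 2, and connecting the components of [J] costs at least two
    traversals each, so that the length is at least
    [8m - #isolated + 2 (#components - 1)]. The Petersen graph is not
    Hamiltonian, so every gadget contains an isolated vertex of [J], or a whole
    cycle of [J], or else separates [J] into a left and a right part. Between
    consecutive separating gadgets there is a component of [J] unless the parts
    facing each other are empty, so [g] separating gadgets yield [g/2] further
    components. Altogether a tour has length at least [9m - 3]. *)

(** * Parity and label crossings in closed walks *)

Section Walks.
Variable T : finType.
Implicit Types (x y a b : T) (p : seq T).

Definition steps x p : seq (T * T) := zip (x :: p) p.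

Definition traversals x p a b : nat :=
  count_mem (a, b) (steps x p) + count_mem (b, a) (steps x p).

Definition odd_edge x p : rel T := [rel a b | odd (traversals x p a b)].

Lemma steps_cons x y p : steps x (y :: p) = (x, y) :: steps y p.
Proof. by []. Qed.

Lemma size_steps x p : size (steps x p) = size p.
Proof. by rewrite size_zip /=; lia. Qed.

Lemma traversalsC x p a b : traversals x p a b = traversals x p b a.
Proof. exact: addnC. Qed.

Lemma odd_edge_sym x p : symmetric (odd_edge x p).
Proof. by move=> a b; rewrite /odd_edge /= [in LHS]traversalsC. Qed.

Lemma mem_steps_path (e : rel T) x p a b :
  path e x p -> (a, b) \in steps x p -> e a b.
Proof.
elim: p x => //= y p IH x /andP[exy pth].
by rewrite steps_cons inE => /orP[/eqP[-> ->]|/(IH _ pth)].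
Qed.

Lemma mem_steps x p a b :
  (a, b) \in steps x p -> (a \in x :: p) && (b \in x :: p).
Proof.
elim: p x => //= y p IH x; rewrite steps_cons inE => /orP[/eqP[-> ->]|/IH].
  by rewrite !inE !eqxx orbT.
by case/andP => ha hb; rewrite [a \in x :: _]in_cons [b \in x :: _]in_cons ha hb !orbT.
Qed.

Lemma traversals_gt0 x p a b :
  (0 < traversals x p a b) = ((a, b) \in steps x p) || ((b, a) \in steps x p).
Proof. by rewrite addn_gt0 -!has_count !has_pred1. Qed.

Lemma odd_edge_sub (e : rel T) x p :
  symmetric e -> path e x p -> subrel (odd_edge x p) e.
Proof.
move=> es pth a b /odd_gt0; rewrite traversals_gt0.
by case/orP => /(mem_steps_path pth) //; rewrite es.
Qed.

Lemma sum_count_fst (s : seq (T * T)) a :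
  \sum_b count_mem (a, b) s = count_mem a (unzip1 s).
Proof.
elim: s => [|[c d] s IH] /=; first by rewrite big1.
rewrite big_split /= IH; congr addn.
rewrite (bigD1 d) //= big1 ?addn0; first by rewrite xpair_eqE eqxx andbT.
by move=> b; rewrite xpair_eqE eq_sym => /negbTE ->; rewrite andbF.
Qed.

Lemma sum_count_snd (s : seq (T * T)) a :
  \sum_b count_mem (b, a) s = count_mem a (unzip2 s).
Proof.
elim: s => [|[c d] s IH] /=; first by rewrite big1.
rewrite big_split /= IH; congr addn.
rewrite (bigD1 c) //= big1 ?addn0; first by rewrite xpair_eqE eqxx.
by move=> b; rewrite xpair_eqE eq_sym => /negbTE ->.
Qed.

Lemma sum_traversals x p : \sum_a \sum_b traversals x p a b = (size p).*2.
Proof.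
have count_sum (s : seq T) : \sum_a count_mem a s = size s.
  elim: s => [|c s IH] /=; first by rewrite big1.
  rewrite big_split /= IH -add1n; congr addn.
  rewrite (bigD1 c) //= eqxx big1 // => b.
  by rewrite eq_sym => /negbTE ->.
rewrite -addnn.
have {1}-> : size p = \sum_a count_mem a (unzip1 (steps x p)).
  by rewrite count_sum size_map size_steps.
have -> : size p = \sum_a count_mem a (unzip2 (steps x p)).
  by rewrite count_sum size_map size_steps.
rewrite -big_split /=.
by apply: eq_bigr => a _; rewrite big_split /= sum_count_fst sum_count_snd.
Qed.

(** A closed walk starts as many steps at [a] as it ends there, so the traversal counts at [a] have
    an even sum. *)
Lemma closed_walk_even x p a :
  last x p = x -> ~~ odd (\sum_b odd_edge x p a b).
Proof.
move=> lst.
have -> : odd (\sum_b odd_edge x p a b) = odd (\sum_b traversals x p a b).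
  rewrite (big_morph odd oddD (erefl _)) [in RHS](big_morph odd oddD (erefl _)).
  by apply: eq_bigr => b _; rewrite oddb.
rewrite big_split /= sum_count_fst sum_count_snd /steps.
rewrite unzip2_zip // -{1}[p]/(behead (x :: p)).
have -> : unzip1 (zip (x :: p) p) = belast x p.
  by elim: p x {lst} => //= y p IH x; rewrite -IH.
have := congr1 (count_mem a) (lastI x p).
rewrite lst -cats1 count_cat /= addn0 addnC => /addIn ->.
by rewrite addnn odd_double.
Qed.

Section Labels.
Variables (K : finType) (lab : T -> K).

(** Ordered pairs: a crossed edge counts in both directions, as in the double sum of
    [traversals]. *)
Definition crossings x p : {set T * T} :=
  [set ab | (lab ab.1 != lab ab.2) && (0 < traversals x p ab.1 ab.2)].

(** Read the walk from its end: a head with a new label is itself a new vertex, so its first edge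
    yields two new ordered pairs. The 2 pays for the label of the last vertex. *)
Lemma labels_le_crossings x p :
  (#|lab @: [set a in x :: p]|).*2 <= #|crossings x p| + 2.
Proof.
elim: p x => [|y p IH] x.
  have -> : [set a in [:: x]] = [set x] by apply/setP => a; rewrite !inE.
  by rewrite imset_set1 cards1 leq_addl.
have -> : [set a in x :: y :: p] = x |: [set a in y :: p].
  by apply/setP => a; rewrite !inE.
rewrite imsetU1.
have sub : crossings y p \subset crossings x (y :: p).
  apply/subsetP => -[a b]; rewrite !inE /= => /andP[-> /=].
  by rewrite !traversals_gt0 steps_cons !inE => /orP[] ->; rewrite ?orbT.
case: (boolP (lab x \in lab @: [set a in y :: p])) => hx.
  rewrite (setUidPr _) ?sub1set //.
  by apply: leq_trans (IH y) _; rewrite leq_add2r subset_leq_card.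
rewrite cardsU1 hx /=.
have nxt : forall c, c \in y :: p -> lab x != lab c.
  move=> c hc; apply: contra hx => /eqP ->.
  by apply: imset_f; rewrite inE.
have xy : lab x != lab y by apply: nxt; rewrite mem_head.
suff : #|(x, y) |: ((y, x) |: crossings y p)| <= #|crossings x (y :: p)|.
  have new a b : (a == x) || (b == x) -> (a, b) \notin crossings y p.
    move=> hab; rewrite inE /= negb_and -leqNgt leqn0 orbC; apply/orP; left.
    apply: contraT; rewrite -lt0n traversals_gt0.
    have /negbTE xn : x \notin y :: p by apply/negP => /nxt; rewrite eqxx.
    by case/orP=> /mem_steps; case/orP: hab => /eqP ->; rewrite xn ?andbF.
  rewrite !cardsU1 in_setU1 negb_or !new ?eqxx ?orbT // xpair_eqE.
  case: (x =P y) xy => [->|_ _]; first by rewrite eqxx.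
  move: (IH y) => /=.
  by move: #|crossings x (y :: p)| #|crossings y p| #|_| => c1 c2 l; lia.
apply: subset_leq_card; rewrite !subUset !sub1set sub andbT !inE /=.
by rewrite xy eq_sym xy !traversals_gt0 steps_cons !inE !eqxx !orbT.
Qed.

(* A step between two labels follows an edge traversed an even, hence at
   least 2, number of times; reaching all labels takes at least
   [#labels - 1] such edges. *)
Lemma closed_walk_labels x p :
  (forall v, v \in x :: p) ->
  (forall a b, odd_edge x p a b -> lab a = lab b) ->
  \sum_a \sum_b odd_edge x p a b + 4 * #|lab @: [set: T]| <= (size p).*2 + 4.
Proof.
move=> cover inv.
have := labels_le_crossings x p.
have -> : [set a in x :: p] = setT by apply/setP => a; rewrite inE cover inE.
suff : \sum_a \sum_b odd_edge x p a b + 2 * #|crossings x p|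
       <= \sum_a \sum_b traversals x p a b.
  by rewrite sum_traversals; lia.
rewrite !pair_big /= -sum1_card big_distrr /=.
rewrite [X in _ + X <= _]big_mkcond -big_split /=.
apply: leq_sum => -[a b] _ /=; rewrite inE /=.
rewrite [odd_edge _ _ _ _]/odd_edge /=.
case: (lab a =P lab b) => /= [_|nlab].
  by rewrite addn0; case: (traversals x p a b) => //= k; case: odd.
have : ~~ odd (traversals x p a b) by apply/negP => /inv.
by case: (traversals x p a b) => [|[|k]] //= /negbTE ->.
Qed.

End Labels.
End Walks.

(** * Cycles with one edge or one vertex removed *)

Section CyclicOrder.
Variable n : nat.
Implicit Types i j : 'I_n.+1.

Lemma val_iter_ordS k i : iter k (@ordS n.+1) i = (i + k) %% n.+1 :> nat.
Proof.
elim: k => [|k IH]; first by rewrite addn0 modn_small.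
by rewrite iterS /= IH -addn1 modnDml addn1 addnS.
Qed.

Lemma iter_ordS_neq k i : k < n -> iter k.+1 (@ordS n.+1) i != i.
Proof.
move=> kn; apply/eqP => /(congr1 (@nat_of_ord _))/eqP; apply/negP.
rewrite val_iter_ordS -[X in _ != X](modn_small (ltn_ord i)).
by rewrite -[X in _ != X %% _]addn0 eqn_modDl mod0n modn_small.
Qed.

(** Going round from [ordS i0], every element is reached before the step out of [i0] would be
    taken. *)
Lemma cycle_minus_edge (e : rel 'I_n.+1) i0 :
  reflexive e -> symmetric e -> transitive e ->
  (forall i, i != i0 -> e i (ordS i)) -> forall i j, e i j.
Proof.
move=> er es et step.
have from_start k : k <= n -> e (ordS i0) (iter k (@ordS _) (ordS i0)).
  elim: k => [|k IH] kn; first exact: er.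
  apply: et (IH (ltnW kn)) _; apply: step.
  by rewrite -iterSr iter_ordS_neq.
have all_start j : e (ordS i0) j.
  have -> : j = iter ((j + (n.+1 - ordS i0)) %% n.+1) (@ordS _) (ordS i0).
    apply: val_inj; rewrite /= val_iter_ordS modnDmr addnCA subnKC.
      by rewrite modnDr modn_small.
    exact: ltnW (ltn_ord (ordS i0)).
  by apply: from_start; rewrite -ltnS ltn_mod.
by move=> i j; apply: et (all_start j); rewrite es.
Qed.

End CyclicOrder.

Lemma cycle_minus_vertex n (e : rel 'I_n.+2) i0 :
  reflexive e -> symmetric e -> transitive e ->
  (forall i, i != i0 -> ordS i != i0 -> e i (ordS i)) ->
  forall i j, i != i0 -> j != i0 -> e i j.
Proof.
move=> er es et step i j ii0 ji0.
(* Contracting [i0] into its successor turns the missing vertex into a missing edge out of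
   [ord_pred i0]. *)
pose f k := if k == i0 then ordS i0 else k.
have := @cycle_minus_edge _ (fun k l => e (f k) (f l)) (ord_pred i0).
rewrite /f; move/(_ _ _ _ _ i j); rewrite (negbTE ii0) (negbTE ji0); apply.
- by move=> k; apply: er.
- by move=> k l; apply: es.
- by move=> k l m; apply: et.
move=> k kp; have ki0 : ordS k != i0.
  by apply: contra kp => /eqP <-; rewrite ordSK.
rewrite (negbTE ki0); case: (k =P i0) => [<-|/eqP kni0]; first exact: er.
exact: step.
Qed.

(** * The necklace graph *)

Definition oct (k : nat) : 'I_8 := Ordinal (ltn_pmod k (isT : 0 < 8)).

Lemma oct_ind (P : 'I_8 -> Prop) :
  P (oct 0) -> P (oct 1) -> P (oct 2) -> P (oct 3) ->
  P (oct 4) -> P (oct 5) -> P (oct 6) -> P (oct 7) -> forall x, P x.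
Proof.
move=> P0 P1 P2 P3 P4 P5 P6 P7 x.
suff -> : x = oct x by case: x => [[|[|[|[|[|[|[|[|k]]]]]]]] hk].
by apply: val_inj; rewrite /= modn_small.
Qed.

Section Necklace.
Variable n : nat.
Local Notation V := ('I_n.+2 * 'I_8)%type.
Implicit Types (i j : 'I_n.+2) (x y z : 'I_8) (v w : V).

(* The gadget is the 8-cycle [0, .., 7] with the chords [1-5] and [3-7]; the
   vertices [2] and [6] of a gadget are linked to [0] and [4] of the next. *)
Definition mate v : V :=
  if odd v.2 then (v.1, oct (v.2 + 4))
  else if v.2 %% 4 == 0 then (ord_pred v.1, oct (v.2 + 2))
  else (ordS v.1, oct (v.2 + 6)).

Definition nbrs v : seq V := [:: (v.1, ordS v.2); (v.1, ord_pred v.2); mate v].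

Definition necklace : rel V := [rel v w | w \in nbrs v].

Lemma mateK : involutive mate.
Proof.
case=> i x; elim/oct_ind: x; rewrite /mate /= ?ordSK ?ord_predK.
all: by apply/eqP; rewrite xpair_eqE eqxx.
Qed.

Lemma nbrs_uniq v : uniq (nbrs v).
Proof.
case: v => i x; rewrite /= !inE !xpair_eqE andbT.
by elim/oct_ind: x; rewrite /mate /= !xpair_eqE -!val_eqE /= !andbF.
Qed.

Lemma necklace_sym : symmetric necklace.
Proof.
suff sub v w : necklace v w -> necklace w v.
  by move=> v w; apply/idP/idP => /sub.
rewrite /necklace /= !inE => /or3P[] /eqP ->.
- by rewrite /= ordSK -surjective_pairing eqxx orbT.
- by rewrite /= ord_predK -surjective_pairing eqxx.
- by rewrite mateK eqxx !orbT.
Qed.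

Lemma necklace_simple : simple_graph necklace.
Proof.
split; last exact: necklace_sym.
case=> i x; rewrite /necklace /= !inE /mate /= !xpair_eqE.
by elim/oct_ind: x; rewrite /= !xpair_eqE -!val_eqE /= !andbF.
Qed.

Lemma necklace_cubic : cubic necklace.
Proof.
move=> v; rewrite -[RHS]/(size (nbrs v)) -(card_uniqP (nbrs_uniq v)).
by apply: eq_card => w; rewrite inE.
Qed.

(** * 3-connectivity of the necklace *)

Section Deletion.
Variable S : {set V}.
Hypothesis S_lt3 : #|S| < 3.
Local Notation conn := (connect (del_rel necklace S)).

Lemma conn_sym : symmetric conn.
Proof.
apply: sym_connect_sym => v w.
by apply/and3P/and3P => -[vw vS wS]; split=> //; rewrite necklace_sym.
Qed.

Lemma conn_edge v w : v \notin S -> w \notin S -> necklace v w -> conn v w.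
Proof. by move=> vS wS vw; apply: connect1; apply/and3P. Qed.

Lemma conn_mate v : v \notin S -> mate v \notin S -> conn v (mate v).
Proof. by move=> vS mS; apply: conn_edge => //; rewrite /necklace /= !inE eqxx !orbT. Qed.

Lemma conn_ordS i x :
  (i, x) \notin S -> (i, ordS x) \notin S -> conn (i, x) (i, ordS x).
Proof. by move=> vS mS; apply: conn_edge => //; rewrite /necklace /= !inE eqxx. Qed.

(** The 8-cycle of a gadget survives the loss of one vertex as a path. *)
Lemma gadget_conn i :
  (forall x y, (i, x) \in S -> (i, y) \in S -> x = y) ->
  forall x y, (i, x) \notin S -> (i, y) \notin S -> conn (i, x) (i, y).
Proof.
move=> S1 x y xS yS; pose e x y := conn (i, x) (i, y).
have er : reflexive e by move=> z; apply: connect0.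
have es : symmetric e by move=> z t; apply: conn_sym.
have et : transitive e by move=> z t u; apply: connect_trans.
case: (pickP (fun s => (i, s) \in S)) => [s sS|S0].
  have notS z : z != s -> (i, z) \notin S.
    by apply: contra => zS; rewrite (S1 _ _ zS sS).
  apply: (@cycle_minus_vertex _ e s) => // [z zs ozs||].
  - by apply: conn_ordS; apply: notS.
  - by apply: contraNneq xS => ->.
  - by apply: contraNneq yS => ->.
apply: (@cycle_minus_edge _ e ord0) => // z _.
by apply: conn_ordS; rewrite S0.
Qed.

(** Each gadget stays connected, so only links matter. Both links between consecutive gadgets can be
    cut in at most one place, and a cycle minus an edge is connected. *)
Lemma spread_conn :
  (forall i x y, (i, x) \in S -> (i, y) \in S -> x = y) ->
  forall v w, v \notin S -> w \notin S -> conn v w.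
Proof.
move=> S1.
pose h i : V := if (i, oct 0) \in S then (i, oct 1) else (i, oct 0).
have hE i : h i = (i, (h i).2) by rewrite /h; case: ifP.
have hS i : h i \notin S.
  rewrite /h; case: ifPn => // h0; apply/negP => h1.
  by have := S1 _ _ _ h0 h1.
have to_h v : v \notin S -> conn v (h v.1).
  move=> vS; rewrite hE [v]surjective_pairing; apply: gadget_conn => //.
  - exact: S1.
  - by rewrite -surjective_pairing.
  - by rewrite -hE.
pose blocked i := [forall x : 'I_8, (x %% 4 == 2) ==>
  (((i, x) \in S) || (mate (i, x) \in S))].
have one_blocked i j : blocked i -> blocked j -> i = j.
  have pickS k x : blocked k -> x %% 4 == 2 ->
      exists2 c, c \in S & c = (k, x) \/ c = mate (k, x).
    move=> /forallP/(_ x)/implyP bx /bx /orP[] hc; last by exists (mate (k, x)); auto.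
    by exists (k, x); auto.
  move=> bi bj; apply/eqP; apply: contraT => ij.
  (* Distinct links share no end, so three of the four cut links already give three deleted
     vertices. *)
  have [c0 c0S c0E] := pickS i (oct 2) bi isT.
  have [c1 c1S c1E] := pickS i (oct 6) bi isT.
  have [c2 c2S c2E] := pickS j (oct 2) bj isT.
  have : uniq [:: c0; c1; c2].
    case: c0E c1E c2E => -> [] -> [] ->; rewrite /mate /= !inE !xpair_eqE.
    all: rewrite ?(inj_eq (@ordS_inj _)) ?(negbTE ij) ?andbF ?orbF //.
  move/card_uniqP => /= c3; suff : 3 <= #|S| by rewrite leqNgt S_lt3.
  rewrite -[X in X <= _]c3; apply: subset_leq_card; apply/subsetP => c.
  by rewrite !inE => /or3P[] /eqP ->.
have unblocked i : ~~ blocked i -> conn (h i) (h (ordS i)).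
  rewrite negb_forall => /existsP[x]; rewrite negb_imply negb_or.
  case/and3P => x2 xS mS.
  have mE : (mate (i, x)).1 = ordS i by elim/oct_ind: x x2 {xS mS}.
  apply: (@connect_trans _ _ (i, x)); first by rewrite conn_sym to_h.
  by apply: connect_trans (conn_mate xS mS) _; rewrite -mE to_h.
have h_conn i j : conn (h i) (h j).
  pose e i j := conn (h i) (h j).
  have er : reflexive e by move=> z; apply: connect0.
  have es : symmetric e by move=> z t; apply: conn_sym.
  have et : transitive e by move=> z t u; apply: connect_trans.
  case: (pickP blocked) => [i0 bi0|b0].
    apply: (@cycle_minus_edge _ e i0) => // k ki0; apply: unblocked.
    by apply: contra ki0 => bk; rewrite (one_blocked _ _ bk bi0).
  by apply: (@cycle_minus_edge _ e ord0) => // k _; apply: unblocked; rewrite b0.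
move=> v w vS wS; apply: connect_trans (to_h _ vS) _.
by apply: connect_trans (h_conn _ w.1) _; rewrite conn_sym to_h.
Qed.

(** The gadgets other than [i0] are intact and form a connected chain; every surviving vertex of
    [i0] has a way out to them, the even ones by their own link. *)
Lemma concentrated_conn i0 x0 y0 :
  x0 != y0 -> (i0, x0) \in S -> (i0, y0) \in S ->
  forall v w, v \notin S -> w \notin S -> conn v w.
Proof.
move=> xy xS yS.
have SE : S = [set (i0, x0); (i0, y0)].
  apply/eqP; rewrite eq_sym eqEcard subUset !sub1set xS yS /= cards2.
  by rewrite xpair_eqE eqxx /= xy.
have off i x : i != i0 -> (i, x) \notin S.
  by move=> ii0; rewrite SE !inE !xpair_eqE (negbTE ii0).
have gadget i x y : i != i0 -> conn (i, x) (i, y).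
  move=> ii0; apply: gadget_conn; rewrite ?off // => z t.
  by rewrite (negbTE (off i z ii0)).
have others i j x y : i != i0 -> j != i0 -> conn (i, x) (j, y).
  move=> ii0 ji0; apply: connect_trans (gadget i x (oct 0) ii0) _.
  apply: connect_trans (gadget j (oct 0) y ji0).
  pose e i j := conn (i, oct 0) (j, oct 0).
  apply: (@cycle_minus_vertex _ e i0) => // [z|z t|z t u|k ki0 oki0].
  - exact: connect0.
  - exact: conn_sym.
  - exact: connect_trans.
  apply: connect_trans (gadget k (oct 0) (oct 2) ki0) _.
  have -> : (ordS k, oct 0) = mate (k, oct 2).
    by rewrite /mate /=; congr pair; apply: val_inj.
  by apply: conn_mate; rewrite off.
have even_out x : ~~ odd x -> (i0, x) \notin S ->
    exists2 v, conn (i0, x) v & v.1 != i0.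
  move=> ev xnS.
  have out : (mate (i0, x)).1 != i0.
    have oi0 : ordS i0 != i0 by apply: (@iter_ordS_neq _ 0).
    rewrite /mate /= (negbTE ev); case: ifP => _ //=.
    by apply: contra oi0 => /eqP e; rewrite -{1}e ord_predK.
  exists (mate (i0, x)) => //; apply: conn_mate => //.
  by rewrite [mate _]surjective_pairing off.
have exit v : v \notin S -> exists2 w, conn v w & w.1 != i0.
  case: v => i x vS; case: (i =P i0) => [ei|/eqP ii0]; last first.
    by exists (i, x); rewrite ?connect0.
  rewrite {i}ei in vS *; case: (boolP (odd x)) => ox; last exact: even_out.
  have via y : conn (i0, x) (i0, y) -> ~~ odd y -> (i0, y) \notin S ->
      exists2 w, conn (i0, x) w & w.1 != i0.
    move=> cxy ey yS'; have [w cw wi] := even_out y ey yS'.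
    by exists w => //; apply: connect_trans cw.
  case: (boolP ((i0, ordS x) \in S)) => [s1|s1]; last first.
    apply: (via (ordS x)) => //; first exact: conn_ordS.
    by elim/oct_ind: x ox {vS via s1}.
  case: (boolP ((i0, ord_pred x) \in S)) => [s2|s2]; last first.
    apply: (via (ord_pred x)) => //; last by elim/oct_ind: x ox {vS via s1 s2}.
    by rewrite conn_sym -{2}[x]ord_predK conn_ordS // ord_predK.
  (* Both cycle neighbours of the odd vertex [x] are deleted, hence nothing else is: the chord leads
     to [x + 4], whose even successor survives and has a link. *)
  have SE2 : S = [set (i0, ordS x); (i0, ord_pred x)].
    apply/eqP; rewrite eq_sym eqEcard subUset !sub1set s1 s2 /= cards2.
    rewrite xpair_eqE eqxx /= -ltnS; apply: leq_trans S_lt3 _.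
    by elim/oct_ind: x {ox vS via s1 s2}.
  have mE : mate (i0, x) = (i0, oct (x + 4)) by rewrite /mate ox.
  have mS : mate (i0, x) \notin S.
    by rewrite mE SE2 !inE !xpair_eqE eqxx -!val_eqE; elim/oct_ind: x ox {vS via s1 s2 SE2 mE}.
  have pS : (i0, ordS (oct (x + 4))) \notin S.
    by rewrite SE2 !inE !xpair_eqE eqxx -!val_eqE; elim/oct_ind: x ox {vS via s1 s2 SE2 mE mS}.
  apply: (via (ordS (oct (x + 4)))) => //; last by elim/oct_ind: x ox {vS via s1 s2 SE2 mE mS pS}.
  apply: connect_trans (conn_mate vS mS) _; rewrite mE in mS *.
  exact: conn_ordS.
move=> v w /exit[[i x] cv vi] /exit[[j y] cw wj].
apply: connect_trans cv _; rewrite conn_sym; apply: connect_trans cw _.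
exact: others.
Qed.

End Deletion.

Lemma necklace_3connected : k_connected 3 necklace.
Proof.
split; first by rewrite card_prod !card_ord; lia.
move=> S S3 v w.
case: (boolP [exists i, exists x, exists y,
         [&& x != y, (i, x) \in S & (i, y) \in S]]).
  by case/existsP=> i /existsP[x /existsP[y /and3P[xy xS yS]]];
     apply: concentrated_conn xy xS yS _ _.
rewrite negb_exists => /forallP S1; apply: spread_conn => // i x y xS yS.
have := S1 i; rewrite negb_exists => /forallP/(_ x).
rewrite negb_exists => /forallP/(_ y).
by rewrite xS yS !andbT negbK => /eqP.
Qed.

Lemma card_sum_set (A B : finType) (L : {set A + B}) :
  #|L| = #|inl @^-1: L| + #|inr @^-1: L|.
Proof.
rewrite -!sum1_card big_sumType /=.
by congr addn; apply: eq_bigl => x; rewrite inE.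
Qed.

(** * Even subgraphs inside a gadget *)

Section EvenSubgraph.
Variable J : rel V.
Hypotheses (J_sym : symmetric J) (J_sub : subrel J necklace).
Hypothesis J_even : forall v, ~~ odd (\sum_w J v w).

Definition isolated v := \sum_w J v w == 0.

Lemma degE v : \sum_w J v w =
  J v (v.1, ordS v.2) + J v (v.1, ord_pred v.2) + J v (mate v).
Proof.
rewrite (bigID (mem (nbrs v))) /= [X in _ + X]big1 => [|w wv]; last first.
  by apply/eqP; rewrite eqb0; apply: contra wv => /J_sub.
rewrite addn0 -big_uniq ?nbrs_uniq //=.
by rewrite !big_cons big_nil addn0 addnA.
Qed.

Lemma deg_cases v : \sum_w J v w = if isolated v then 0 else 2.
Proof.
move: (J_even v); rewrite /isolated degE.
by case: J; case: J; case: J.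
Qed.

Lemma sum_deg : \sum_v \sum_w J v w + 2 * #|[set v | isolated v]| = 16 * n.+2.
Proof.
rewrite -sum1_card big_distrr /= [X in _ + X]big_mkcond -big_split /=.
transitivity (\sum_(v : V) 2).
  by apply: eq_bigr => v _; rewrite deg_cases inE; case: isolated.
by rewrite sum_nat_const card_prod !card_ord; lia.
Qed.

Lemma not_isolated v w : J v w -> isolated v = false.
Proof. by move=> vw; rewrite /isolated (bigD1 w) //= vw. Qed.

Definition spanned i := [forall x : 'I_8, ~~ isolated (i, x)].

(* For [c = true] the set [A] is a union of components of [J] inside the
   gadget [i]; otherwise [A] is the right part of a splitting of [J] with the
   links at [2, 6] in it and the links at [0, 4] outside it. *)
Definition gadget_cut i (A : 'I_8 -> bool) (c : bool) :=
  (forall x y, J (i, x) (i, y) -> A x = A y) /\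
  if c then (exists x, A x) /\ forall x, ~~ odd x -> J (i, x) (mate (i, x)) -> ~~ A x
  else forall x, ~~ odd x -> J (i, x) (mate (i, x)) -> A x = (x %% 4 == 2).

(** The edge from [k] to [k + 1] mod 8 is encoded by [e0], ..., [e7], the chords 1-5 and 3-7 by [c1]
    and [c3], the links by [d0], ..., [d6]; the equations are the degrees at 0, ..., 7. The [take 8]
    keeps the witness of nonemptiness inside the gadget. *)
Lemma gadget_cut_bool (e0 e1 e2 e3 e4 e5 e6 e7 c1 c3 d0 d2 d4 d6 : bool) :
  e0 + e7 + d0 = 2 -> e1 + e0 + c1 = 2 -> e2 + e1 + d2 = 2 ->
  e3 + e2 + c3 = 2 -> e4 + e3 + d4 = 2 -> e5 + e4 + c1 = 2 ->
  e6 + e5 + d6 = 2 -> e7 + e6 + c3 = 2 ->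
  exists (A : seq bool) (c : bool),
    let a := nth false A in
    [/\ [&& e0 ==> (a 0 == a 1), e1 ==> (a 1 == a 2), e2 ==> (a 2 == a 3),
          e3 ==> (a 3 == a 4), e4 ==> (a 4 == a 5), e5 ==> (a 5 == a 6),
          e6 ==> (a 6 == a 7) & e7 ==> (a 7 == a 0)],
        (c1 ==> (a 1 == a 5)) && (c3 ==> (a 3 == a 7)) &
        if c then [&& has id (take 8 A), d0 ==> ~~ a 0, d2 ==> ~~ a 2,
                      d4 ==> ~~ a 4 & d6 ==> ~~ a 6]
        else [&& d0 ==> ~~ a 0, d2 ==> a 2, d4 ==> ~~ a 4 & d6 ==> a 6]].
Proof.
(* At most 11 cases survive: the edges outside [J] form a perfect matching of
   the gadget with its four half-edges. *)
pose s k : seq bool := nth [::]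
 [:: [:: true; true; true; true; true; true; true; true];
  [:: false; false; false; true; true; true; true; true];
  [:: true; true; true; true; false; false; false; true];
  [:: false; true; true; true; true; true; false; false];
  [:: true; true; false; false; false; true; true; true];
  [:: false; false; true; true; false; false; true; true];
  [:: false; true; true; false; false; true; true; false]] k.
case: e0; case: e7; case: d0 => //=; case: e1; case: c1 => //=;
case: e2; case: d2 => //=; case: e3; case: c3 => //=;
case: e4; case: d4 => //=; case: e5 => //=; case: e6; case: d6 => //= *.
(* Here [s 0] is the whole gadget, [s 1] to [s 4] are the 5-cycles through one chord, [s 5] and
   [s 6] are right parts of four vertices, and [[::]] is the empty right part. *)
all: first [ by exists (s 0), true | by exists (s 1), true
  | by exists (s 2), true | by exists (s 3), true | by exists (s 4), true
  | by exists (s 0), false | by exists (s 5), false | by exists (s 6), false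
  | by exists [::], false ].
Qed.

Lemma gadget_cut_exists i : spanned i -> exists A c, gadget_cut i A c.
Proof.
move=> /forallP noiso.
pose e k := J (i, oct k) (i, oct k.+1).
pose d k := J (i, oct k) (mate (i, oct k)).
have octS k : ordS (oct k) = oct k.+1.
  by apply: val_inj; rewrite /= -addn1 modnDml addn1.
have oct_pred k : ord_pred (oct k.+1) = oct k by rewrite -octS ordSK.
have oct8 k : oct (k + 8) = oct k by apply: val_inj; rewrite /= modnDr.
(* Stated at [oct k.+1] to avoid a predecessor index; vertex 0 occurs as [oct 8]. *)
have deg2 k : e k.+1 + e k + d k.+1 = 2.
  have := deg_cases (i, oct k.+1); rewrite (negbTE (noiso _)) degE /=.
  by rewrite octS oct_pred [J _ (i, oct k)]J_sym.
have mate1 : mate (i, oct 1) = (i, oct 5) by [].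
have mate5 : mate (i, oct 5) = (i, oct 1) by rewrite -mate1 mateK.
have mate3 : mate (i, oct 3) = (i, oct 7) by [].
have mate7 : mate (i, oct 7) = (i, oct 3) by rewrite -mate3 mateK.
have d5 : d 5 = d 1 by rewrite /d mate1 mate5 J_sym.
have d7 : d 7 = d 3 by rewrite /d mate3 mate7 J_sym.
have e8 : e 8 = e 0 by rewrite /e -(oct8 0) -(oct8 1).
have d8 : d 8 = d 0 by rewrite /d -(oct8 0).
have := deg2 4; have := deg2 6; have := deg2 7; rewrite d5 d7 e8 d8 => D0 D7 D5.
have [s [c []]] := gadget_cut_bool D0 (deg2 0) (deg2 1) (deg2 2) (deg2 3) D5
  (deg2 5) D7.
case/and5P=> h0 h1 h2 h3 /and4P[h4 h5 h6 h7] /andP[h15 h37] hc.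
exists (fun x => nth false s x), c; split.
  have step x : J (i, x) (i, ordS x) -> nth false s x = nth false s (ordS x).
    elim/oct_ind: x; rewrite octS.
    - by move/(implyP h0)/eqP.
    - by move/(implyP h1)/eqP.
    - by move/(implyP h2)/eqP.
    - by move/(implyP h3)/eqP.
    - by move/(implyP h4)/eqP.
    - by move/(implyP h5)/eqP.
    - by move/(implyP h6)/eqP.
    - by move/(implyP h7)/eqP.
  move=> x y xy; have := J_sub xy; rewrite /necklace /= !inE !xpair_eqE eqxx /=.
  case/or3P=> [/eqP yE|/eqP yE|/eqP yE].
  - by rewrite yE in xy *; apply: step.
  - by rewrite yE in xy *; symmetry; rewrite -{2}[x]ord_predK; apply: step;
      rewrite ord_predK J_sym.
  (* An even [x] is impossible here: its mate lies in another gadget. *)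
  case: (boolP (odd x)) => ox; last first.
    have oi : ordS i != i by apply: (@iter_ordS_neq _ 0).
    move/(congr1 fst): yE; rewrite /mate /= (negbTE ox); case: ifP => _ /= /eqP.
      by move=> /eqP e1; case/eqP: oi; rewrite {1}e1 ord_predK.
    by rewrite eq_sym (negbTE oi).
  rewrite yE in xy; move: yE xy; elim/oct_ind: x ox => // _.
  - by rewrite mate1 => -[->] /(implyP h15)/eqP.
  - by rewrite mate3 => -[->] /(implyP h37)/eqP.
  - by rewrite mate5 => -[->]; rewrite J_sym => /(implyP h15)/eqP.
  - by rewrite mate7 => -[->]; rewrite J_sym => /(implyP h37)/eqP.
case: c hc => [/and5P[hA]|/and4P[]] k0 k2 k4 k6; last first.
  elim/oct_ind => // _.
  - by move/(implyP k0)/negbTE.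
  - by move/(implyP k2).
  - by move/(implyP k4)/negbTE.
  - by move/(implyP k6).
split; last first.
  by elim/oct_ind => // _; [exact: (implyP k0)|exact: (implyP k2)
    |exact: (implyP k4)|exact: (implyP k6)].
have [b] := hasP hA; case/(nthP false) => k; rewrite size_take_min leq_min => /andP[k8 _] <- nz.
exists (oct k).
by rewrite /= modn_small // -(nth_take _ k8).
Qed.

(** * Labels constant on components, and their number *)

Section Labelling.
Variables (A : 'I_n.+2 -> 'I_8 -> bool) (c : 'I_n.+2 -> bool).
Hypothesis cutP : forall i, spanned i -> gadget_cut i (A i) (c i).

Definition splits i := spanned i && ~~ c i.

Definition nb_splits k : nat := \sum_(0 <= j < k) splits (inord j).

Definition segment v := nb_splits v.1 + (splits v.1 && A v.1 v.2).

(* The splitting gadgets cut the necklace into segments; two consecutive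
   segments get the same label because one of them may be empty. The last
   segment continues the first one around the necklace. *)
Definition label v : V + ('I_n.+2 + 'I_n.+3) :=
  if isolated v then inl v
  else if [&& spanned v.1, c v.1 & A v.1 v.2] then inr (inl v.1)
  else inr (inr (inord (if segment v == nb_splits n.+2 then 0
                        else (segment v)./2))).

Lemma nb_splitsS k : nb_splits k.+1 = nb_splits k + splits (inord k).
Proof. by rewrite /nb_splits big_nat_recr. Qed.

Lemma nb_splits_le k : nb_splits k <= k.
Proof.
elim: k => [|k IH]; first by rewrite /nb_splits big_geq.
by rewrite nb_splitsS; case: splits; lia.
Qed.

Lemma nb_splits_hit k t : t < nb_splits k ->
  exists j : nat, [/\ j < k, splits (inord j) & nb_splits j = t].
Proof.
elim: k => [|k IH]; first by rewrite /nb_splits big_geq.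
rewrite nb_splitsS; case: (ltnP t (nb_splits k)) => [/IH[j [jk sj jt]] _|tk].
  by exists j; split=> //; apply: ltnW.
by case sk: splits => /= tk'; [exists k; split=> // |]; lia.
Qed.

Lemma label_inner i x y : J (i, x) (i, y) -> label (i, x) = label (i, y).
Proof.
move=> xy; rewrite /label /segment /splits (not_isolated xy).
rewrite J_sym in xy; rewrite (not_isolated xy) /=.
by case: (boolP (spanned i)) => // /cutP[/(_ _ _ xy) ->].
Qed.

(** In a splitting gadget a used link at 2 or 6 ends in the right part, one at 0 or 4 in the left
    part. So both ends lie in segment [nb_splits i.+1], except where the necklace closes up. *)
Lemma label_link i x :
  x %% 4 = 2 -> J (i, x) (mate (i, x)) -> label (i, x) = label (mate (i, x)).
Proof.
move=> x2 xm; have mx := xm; rewrite J_sym in mx.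
have evx : ~~ odd x by elim/oct_ind: x x2 {xm mx}.
have [y mE [evy y0]] : exists2 y, mate (i, x) = (ordS i, y)
    & ~~ odd y /\ y %% 4 != 2.
  exists (mate (i, x)).2; last by elim/oct_ind: x x2 {xm mx evx}.
  by rewrite [LHS]surjective_pairing /mate /= (negbTE evx) x2.
have myE : mate (ordS i, y) = (i, x) by rewrite -mE mateK.
have ym : J (ordS i, y) (mate (ordS i, y)) by rewrite myE -mE.
have inside j z : ~~ odd z -> J (j, z) (mate (j, z)) ->
    [&& spanned j, c j & A j z] = false.
  move=> ez jz; apply/and3P => -[/cutP[_ cut] cj Ajz]; rewrite cj in cut.
  by case: cut => _ /(_ _ ez jz); rewrite Ajz.
have split_side j z : ~~ odd z -> J (j, z) (mate (j, z)) ->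
    splits j && A j z = splits j && (z %% 4 == 2).
  move=> ez jz; case: (boolP (splits j)) => //= /andP[/cutP[_ cut] /negbTE cj].
  by rewrite cj in cut; apply: cut.
rewrite /label (not_isolated xm) (not_isolated mx) (inside i x) //.
rewrite mE (inside (ordS i) y) // /segment /= (split_side i x) //.
rewrite (split_side (ordS i) y) //= x2 eqxx andbT (negbTE y0) andbF.
rewrite addn0; have <- : nb_splits i.+1 = nb_splits i + splits i.
  by rewrite nb_splitsS inord_val.
(* The links from the last gadget to gadget 0 join segment [nb_splits n.+2] to segment 0, and
   [label] identifies these. *)
have := ltn_ord i; rewrite leq_eqVlt => /orP[/eqP[iE]|iS].
  by rewrite iE eqxx modnn /nb_splits big_geq //; case: ifP.
by rewrite modn_small.
Qed.

Lemma label_const v w : J v w -> label v = label w.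
Proof.
case: v w => i x [j y] vw.
have wn : (j, y) \in nbrs (i, x) := J_sub vw.
have := wn; rewrite !inE => /or3P[] /eqP wE; rewrite wE in vw *.
- exact: label_inner.
- exact: label_inner.
case: (boolP (odd x)) => ox.
  by move: vw; rewrite /mate /= ox; apply: label_inner.
case: (x %% 4 =P 2) => x2; first exact: label_link.
have x0 : x %% 4 == 0 by elim/oct_ind: x ox x2 {wn wE vw}.
have : (mate (i, x)).2 %% 4 = 2 by elim/oct_ind: x ox x0 {wn wE x2 vw}.
move: vw (mateK (i, x)); case: (mate (i, x)) => a b vw ab /= b2.
by rewrite -ab in vw *; symmetry; apply: label_link => //; rewrite J_sym.
Qed.

Lemma labels_ge :
  #|[set v | isolated v]| + #|[set i | spanned i && c i]|
  + (nb_splits n.+2)./2 <= #|label @: [set: V]|.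
Proof.
rewrite 2!card_sum_set -addnA.
have hit v k : label v = k -> k \in label @: [set: V] by move=> <-; apply: imset_f.
apply: leq_add; [|apply: leq_add].
- apply: subset_leq_card; apply/subsetP => v; rewrite !inE => iv.
  by apply: (hit v); rewrite /label iv.
- apply: subset_leq_card; apply/subsetP => i; rewrite !inE => /andP[si ci].
  have [_] := cutP si; rewrite ci => -[[x Ax] _].
  apply: (hit (i, x)); rewrite /label /= si ci Ax.
  by rewrite (negbTE (forallP si x)).
have le_g : (nb_splits n.+2)./2 <= n.+3.
  by have := nb_splits_le n.+2; lia.
rewrite -[X in X <= _]card_ord -cardsT.
have widen_inj : injective (widen_ord le_g).
  by move=> t u /(congr1 val) /= /val_inj.
rewrite -(card_imset _ widen_inj).
apply: subset_leq_card; apply/subsetP => _ /imsetP[t _ ->]; rewrite !inE.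
have tg := ltn_ord t.
(* In the splitting gadget preceded by [2t] others, vertex 0 has segment [2t] or [2t + 1], both
   halving to [t]. As [2t + 2] is at most [nb_splits n.+2], neither is the wrapped segment. *)
have tg2 : t.*2 < nb_splits n.+2 by lia.
have [j [jn sj jt]] := nb_splits_hit tg2.
pose i : 'I_n.+2 := inord j; have iE : i = j :> nat by rewrite inordK.
have /andP[si /negbTE ci] := sj.
apply: (hit (i, oct 0)).
rewrite /label /= (negbTE (forallP si (oct 0))) ci andbF.
do 2 congr inr; apply: val_inj.
have segE : segment (i, oct 0) = t.*2 + A i (oct 0).
  by rewrite /segment /= iE jt sj.
rewrite segE /=; have := leq_b1 (A i (oct 0)).
case: eqP => [|_ _]; first by lia.
by rewrite inordK; case: (A i (oct 0)); lia.
Qed.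

End Labelling.
(** Against 16 per gadget, an isolated vertex loses 2 in degree and gains 4 as a label, a gadget
    with a whole component gains 4, and a splitting gadget gains 2, half a label. The final 2 covers
    the rounding when the number of splitting gadgets is odd. *)
Lemma even_subgraph_labels :
  exists (K : finType) (lab : V -> K),
    (forall v w, J v w -> lab v = lab w) /\
    18 * n.+2 <= \sum_v \sum_w J v w + 4 * #|lab @: [set: V]| + 2.
Proof.
have [Ac AcP] : exists Ac : 'I_n.+2 -> ('I_8 -> bool) * bool,
    forall i, spanned i -> gadget_cut i (Ac i).1 (Ac i).2.
  apply: (fin_all_exists (P := fun i Ac => spanned i -> gadget_cut i Ac.1 Ac.2)).
  move=> i; case: (boolP (spanned i)) => [|nsp].
    by move/gadget_cut_exists => [A [c cut]]; exists (A, c).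
  (* A default value for gadgets with an isolated vertex; [splits] and [label] test [spanned]
     first. *)
  by exists (xpred0, true).
pose A i := (Ac i).1; pose c i := (Ac i).2.
exists (V + ('I_n.+2 + 'I_n.+3))%type, (label A c); split.
  exact: label_const.
suff : n.+2 <= #|[set v | isolated v]| + #|[set i | spanned i && c i]|
               + nb_splits c n.+2.
  move: (@labels_ge A c AcP) sum_deg; move: #|label A c @: _| (\sum_v _).
  by move: #|[set v | isolated v]| #|[set i | _]| => I B L D; lia.
have -> : nb_splits c n.+2 = \sum_i splits c i.
  by rewrite /nb_splits big_mkord; apply: eq_bigr => i _; rewrite inord_val.
rewrite -[X in X <= _]card_ord -!sum1_card.
rewrite [X in X + _ + _]big_mkcond [X in _ + X + _]big_mkcond /=.
have -> : \sum_v (if v \in [set v | isolated v] then 1 else 0) =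
          \sum_i \sum_x isolated (i, x).
  by rewrite pair_big; apply: eq_bigr => -[i x] _; rewrite inE; case: isolated.
rewrite -!big_split; apply: leq_sum => i _ /=; rewrite inE /splits.
case: (boolP (spanned i)) => [_|]; first by case: (c i); rewrite ?addn1 ?addn0.
rewrite negb_forall => /existsP[x]; rewrite negbK => ix.
by rewrite (bigD1 x) //= ix.
Qed.

End EvenSubgraph.

(** * The bound on tours and the choice of the necklace *)

Lemma necklace_tour_length v p :
  tsp_tour necklace v p -> 9 * n.+2 <= size p + 3.
Proof.
case=> pth lst cover.
have := @even_subgraph_labels (odd_edge v p) (odd_edge_sym v p).
case=> [||K [lab [inv ge]]].
- exact: odd_edge_sub necklace_sym pth.
- by move=> w; apply: closed_walk_even lst.
move: ge (closed_walk_labels cover inv); move: (\sum_w _) #|lab @: _|.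
by move=> D L; lia.
Qed.

End Necklace.

Local Open Scope ring_scope.

Theorem theorem3 (R : realType) (eps : R) (heps : 0 < eps) :
  exists (T : finType) (g : rel T),
    [/\ simple_graph g, cubic g, k_connected 3 g &
      forall (x : T) (p : seq T), tsp_tour g x p ->
        (9%:R / 8%:R - eps) * (#|T|%:R : R) <= (tour_length p)%:R].
Proof.
(* With [m = n + 2] gadgets there are [8m] vertices, so [9m - 3] suffices once [8 * eps * m] is at
   least 3. *)
pose n := Num.bound (3%:R / (8%:R * eps)).
exists ('I_n.+2 * 'I_8)%type, (@necklace n); split.
- exact: necklace_simple.
- exact: necklace_cubic.
- exact: necklace_3connected.
move=> x p /necklace_tour_length; rewrite /tour_length card_prod !card_ord.
rewrite -(ler_nat R) natrM natrD [(_ * 8)%:R]natrM => tour.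
have : 3%:R / (8%:R * eps) < n.+2%:R :> R.
  apply: lt_trans (archi_boundP _) _; last by rewrite ltr_nat; lia.
  by rewrite divr_ge0 ?mulr_ge0 ?ler0n // ltW.
rewrite ltr_pdivrMr ?mulr_gt0 ?ltr0n // => large.
by move: tour large; lra.
Qed.
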